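(* Let $H$ be a real Hilbert space and let $A_1,A_2:H\to2^H$ and $B:H\to H$ be maximal monotone operators such that $B$ is (single-valued and) $1/\beta$-cocoercive for some $\beta>0$ and the problem of finding $x\in H$ with $$0\in A_1x+A_2x+Bx\qquad(\mathrm{P})$$ admits a solution. Let $\sigma\in[0,1)$, $\gamma\in\left(0,\frac2\beta\right)$, $\alpha=\frac{\gamma\beta}{4-\gamma\beta}$, $w^0\in H$, and let $\{\tilde x_1^k\}_{k\ge1}$ and $\{\tilde x_2^k\}_{k\ge1}$ be sequences generated by the inexact Davis-Yin method described in the context, where it is supposed that the inner loop always ends in a finite number of iterations. Then $\{\tilde x_1^k\}$ and $\{\tilde x_2^k\}$ converge weakly to a solution of $(\mathrm{P})$.
   Context: $B:H\to H$ is $1/\beta$-cocoercive if $\langle Bx-By,x-y\rangle\ge\frac1\beta\|Bx-By\|^2$ for all $x,y\in H$. For a maximal monotone operator $T$, $J_T=(I+T)^{-1}$ denotes its resolvent. Inexact Davis-Yin method. Set $\tilde w^0=\frac{w^0}{1+\alpha}$. Given $\tilde w^k$, the inner loop produces pairs $(\tilde x_1^{k+1},a_1^{k+1})$ with $a_1^{k+1}\in A_1\tilde x_1^{k+1}$ and, for each of them, computes $$\tilde x_2^{k+1}=J_{\gamma A_2}\bigl(\tilde x_1^{k+1}-\gamma a_1^{k+1}-\gamma B\tilde x_1^{k+1}\bigr),$$ improving the pair $(\tilde x_1^{k+1},a_1^{k+1})$ until the criterion $$\|\tilde x_1^{k+1}+\gamma a_1^{k+1}-\tilde w^k\|\le\sigma\left\|\frac{\alpha\tilde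 x_1^{k+1}+\tilde x_2^{k+1}}{1+\alpha}+\gamma a_1^{k+1}-\tilde w^k\right\|$$ is satisfied. Then the update is $$\tilde w^{k+1}=\tilde w^k+\frac1{1+\alpha}(\tilde x_2^{k+1}-\tilde x_1^{k+1}).$$ Thus, when every inner loop terminates, the generated sequences are exactly sequences such that for all $k\ge0$: $a_1^{k+1}\in A_1\tilde x_1^{k+1}$, $\tilde x_2^{k+1}$ is given by the resolvent formula above, the displayed error criterion holds, and the update rule holds. (The values $\tilde x_1^{k+1},\tilde x_2^{k+1},a_1^{k+1}$ are those accepted at termination of the inner loop.) *)

(* Defs.v *)
From HB Require Import structures.
From mathcomp Require Import all_boot all_order all_algebra.
From mathcomp Require Import all_classical all_reals all_analysis.

Set Implicit Arguments.
Unset Strict Implicit.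
Unset Printing Implicit Defensive.

Import Order.TTheory GRing.Theory Num.Theory.
Import numFieldNormedType.Exports.

Local Open Scope classical_set_scope.
Local Open Scope ring_scope.

HB.mixin Record CompleteNormedModule_isHilbert (R : realType) H
    of CompleteNormedModule R H := {
  inner : {dot H for (@idfun R)} ;
  inner_norm : forall x : H, inner x x = `|x| ^+ 2
}.

#[short(type="hilbertType")]
HB.structure Definition Hilbert (R : realType) :=
  {H of CompleteNormedModule_isHilbert R H & CompleteNormedModule R H}.

Section Operators.
Context {R : realType} {H : hilbertType R}.
Implicit Types (A T : H -> set H) (B : H -> H) (u : nat -> H).

Definition weakly_converges u (l : H) :=
  forall y : H, inner (u n) y @[n --> \oo] --> inner l y.

(* A set-valued operator H -> 2^H is a function A : H -> set H;
   [A x v] reads v \in A x. *)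

Definition single_valued B : H -> set H := fun x => [set B x].

Definition op_add A T : H -> set H :=
  fun x => [set v + w | v in A x & w in T x].

Definition op_scale (c : R) A : H -> set H := fun x => [set c *: v | v in A x].

Definition op_inv A : H -> set H := fun y => [set x | A x y].

Definition monotone A :=
  forall x y v w : H, A x v -> A y w -> 0 <= inner (x - y) (v - w).

Definition maximal_monotone A :=
  monotone A /\
  forall T, monotone T -> (forall x, A x `<=` T x) -> T = A.

Definition cocoercive (c : R) B :=
  forall x y : H, c * `|B x - B y| ^+ 2 <= inner (B x - B y) (x - y).

Definition resolvent T : H -> set H :=
  op_inv (op_add (single_valued id) T).

Definition zeros T : set H := [set x | T x 0].

(* The pair (x1 k, a1 k) and the point x2 k are meaningful for k >= 1 only. *)
Record inexact_davis_yin A1 A2 B (alpha gamma sigma : R) (w0 : H)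
    (w x1 a1 x2 : nat -> H) : Prop := {
  idy_init : w 0%N = (1 + alpha)^-1 *: w0 ;
  idy_a1 : forall k, A1 (x1 k.+1) (a1 k.+1) ;
  (* membership: resolvents of monotone operators are at most single-valued *)
  idy_x2 : forall k,
    resolvent (op_scale gamma A2)
      (x1 k.+1 - gamma *: a1 k.+1 - gamma *: B (x1 k.+1)) (x2 k.+1) ;
  idy_error : forall k,
    `|x1 k.+1 + gamma *: a1 k.+1 - w k| <=
    sigma * `|(1 + alpha)^-1 *: (alpha *: x1 k.+1 + x2 k.+1)
              + gamma *: a1 k.+1 - w k| ;
  idy_update : forall k,
    w k.+1 = w k + (1 + alpha)^-1 *: (x2 k.+1 - x1 k.+1)
}.

End Operators.

(* Main.v *)
Require Import Defs.
From mathcomp Require Import all_boot all_order all_algebra.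
From mathcomp Require Import all_classical all_reals all_analysis.
From mathcomp Require Import ring lra.

Import Order.TTheory GRing.Theory Num.Theory.
Import numFieldNormedType.Exports.

Local Open Scope classical_set_scope.
Local Open Scope ring_scope.

(** The method is a hybrid proximal extragradient iteration in disguise.  Put
[lambda = (1 + alpha)^-1 = 1 - gamma * beta / 4], [v = lambda *: (x1 - x2)] and
[y = x1 + gamma *: a1 - v].  Then the update reads [w' = w - v], and the error
criterion reads [`|y + v - w| <= sigma * `|y - w|]: an inexact proximal step on
the operator whose graph consists of the pairs [(y, v)].  That operator is
monotone ([davis_yin_monotone]); this is where cocoercivity of [B] and the exact
value of [alpha] enter.  Its zeros are the points [p + gamma *: u] with
[u \in A1 p] and [- (u + B p) \in A2 p], so that [p] solves the inclusion.

Consequently [w] is Fejer monotone with respect to these zeros and each step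
gains [(1 - sigma ^+ 2) * `|y - w| ^+ 2] ([fejer_decrease]).  Hence [y - w], and
with it [x1 - x2] and [x1 + gamma *: a1 - w], tend to 0 in norm, and all the
sequences are bounded.

Bounded sequences have weak limits along every ultrafilter
([ultrafilter_weak_compactness], from the Riesz representation theorem).  For
limits [r], [v] of [x1] and [a1] along an ultrafilter refining [\oo], adding the
three monotonicity inequalities cancels all products of two weakly convergent
sequences, and maximality then puts the limits in the graphs
([demiclosed_sum]): [r + gamma *: v] is a zero, and it is the weak limit of [w].
By Opial's argument ([opial_uniqueness]) this zero does not depend on the
ultrafilter.  It determines [r], because [r] is the value of the resolvent of
[gamma A1] at it.  So [x1] has the same weak limit along all ultrafilters
refining [\oo], which is weak convergence ([cvg_ultrafilters]). *)

(** * Inner product calculus *)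

Section InnerProduct.
Context {R : realType} {H : hilbertType R}.
Implicit Types (x y z : H) (c : R).

Lemma innerC x y : inner x y = inner y x.
Proof. by rewrite hermC /= expr0 mul1r. Qed.

Lemma innerDl x y z : inner (x + y) z = inner x z + inner y z.
Proof. by rewrite linearDl. Qed.

Lemma innerNl x z : inner (- x) z = - inner x z.
Proof. by rewrite linearNl. Qed.

Lemma innerZl c x z : inner (c *: x) z = c * inner x z.
Proof. by rewrite linearZl. Qed.

Lemma innerDr x y z : inner z (x + y) = inner z x + inner z y.
Proof. by rewrite linearDr. Qed.

Lemma innerNr x z : inner z (- x) = - inner z x.
Proof. by rewrite linearNr. Qed.

Lemma innerZr c x z : inner z (c *: x) = c * inner z x.
Proof. by rewrite linearZr. Qed.

Lemma inner0l x : inner 0 x = 0.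
Proof. by rewrite linear0l. Qed.

Definition innerE := (innerDl, innerNl, innerZl, innerDr, innerNr, innerZr).

Lemma inner_ge0 x : 0 <= inner x x.
Proof. by rewrite inner_norm sqr_ge0. Qed.

Lemma inner_eq0 x : (inner x x == 0) = (x == 0).
Proof. by rewrite inner_norm sqrf_eq0 normr_eq0. Qed.

(** Testing against every vector turns an identity between vectors into one
between scalars, which [innerE] expands and [ring] or [lra] decides. *)
Lemma inner_ext x y : (forall h, inner x h = inner y h) -> x = y.
Proof.
move=> xy; apply/eqP; rewrite -subr_eq0 -inner_eq0 innerDl innerNl xy subrr //.
Qed.

Lemma inner_normM_le x y : `|inner x y| <= `|x| * `|y|.
Proof.
rewrite -(@ler_pXn2r _ 2) ?nnegrE ?mulr_ge0 //.
rewrite exprMn -normrX ger0_norm ?sqr_ge0 // -!inner_norm.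
have [y0|y0] := eqVneq (inner y y) 0.
  move/eqP: y0; rewrite inner_eq0 => /eqP ->.
  by rewrite innerC !inner0l expr0n mulr0.
have yp : 0 < inner y y by rewrite lt0r y0 inner_ge0.
(* This vector is `|y|^2 times the component of x orthogonal to y. *)
have := inner_ge0 (inner y y *: x - inner x y *: y).
rewrite !innerE (innerC y x).
set a := inner x x; set b := inner x y; set d := inner y y in yp *.
rewrite [X in 0 <= X](_ : _ = d * (a * d - b ^+ 2)); last by ring.
by rewrite pmulr_rge0 // subr_ge0.
Qed.

End InnerProduct.

(** * Weak limits along filters *)

Section WeakTopology.
Context {R : realType} {H : hilbertType R}.
Implicit Types (x y l : H).

Definition weakly_cvg_along {T} (F : set_system T) (u : T -> H) l :=
  forall y, inner (u n) y @[n --> F] --> inner l y.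

Definition norm_bounded {T} (u : T -> H) := exists M, forall n, `|u n| <= M.

Lemma inner_cvg0 {T} {F : set_system T} {FF : Filter F} (s g : T -> H) :
  s n @[n --> F] --> (0 : H) -> norm_bounded g ->
  inner (s n) (g n) @[n --> F] --> (0 : R).
Proof.
move=> /norm_cvg0P s0 [M gM].
have sM : `|s n| * M @[n --> F] --> 0.
  by rewrite -[X in _ --> X](mul0r M); exact: cvgM s0 (cvg_cst M).
apply: (@squeeze_cvgr _ _ _ _ (fun n => - (`|s n| * M)) (fun n => `|s n| * M)).
- apply: nearW => n; rewrite -ler_norml.
  by apply: le_trans (inner_normM_le _ _) _; apply: ler_wpM2l.
- by rewrite -[X in _ --> X]oppr0; apply: cvgN.
- exact: sM.
Qed.

Lemma cvg_weakly {T} {F : set_system T} {FF : Filter F} (u : T -> H) l :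
  u n @[n --> F] --> l -> weakly_cvg_along F u l.
Proof.
move=> /subr_cvg0 ul y; apply/subr_cvg0.
under eq_fun do rewrite -innerNl -innerDl.
by apply: (inner_cvg0 (fun n => u n - l) (fun=> y)) => //; exists `|y|.
Qed.

Lemma weakly_cvgD {T} {F : set_system T} {FF : Filter F} (u v : T -> H) l m :
  weakly_cvg_along F u l -> weakly_cvg_along F v m ->
  weakly_cvg_along F (fun n => u n + v n) (l + m).
Proof.
move=> ul vm y; rewrite innerDl; under eq_fun do rewrite innerDl.
exact: cvgD.
Qed.

Lemma weakly_cvgZ {T} {F : set_system T} {FF : Filter F} c (u : T -> H) l :
  weakly_cvg_along F u l -> weakly_cvg_along F (fun n => c *: u n) (c *: l).
Proof.
move=> ul y; rewrite innerZl; under eq_fun do rewrite innerZl.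
exact: cvgM (cvg_cst c) (ul y).
Qed.

Lemma weakly_cvgN {T} {F : set_system T} {FF : Filter F} (u : T -> H) l :
  weakly_cvg_along F u l -> weakly_cvg_along F (fun n => - u n) (- l).
Proof.
move=> ul y; rewrite innerNl; under eq_fun do rewrite innerNl.
exact: cvgN.
Qed.

Lemma cvgr_ge_lim {T} {F : set_system T} {FF : ProperFilter F} (f : T -> R) a b :
  f n @[n --> F] --> b -> (forall n, a <= f n) -> a <= b.
Proof.
move=> fb af; rewrite -(cvg_lim _ fb) //.
by apply: limr_ge; [apply/cvg_ex; exists b | apply: nearW].
Qed.

(** The representing vector minimises [f y = `|y|^2 - 2 phi y].  Any minimising
sequence is Cauchy by the parallelogram law; its limit [l] satisfies the
first-order condition [phi h = inner l h], which is obtained by comparing [f] at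
the points of the sequence with [f] at their translates by [t *: h]. *)
Lemma riesz_representation (phi : H -> R) M :
  (forall x y, phi (x + y) = phi x + phi y) ->
  (forall c x, phi (c *: x) = c * phi x) ->
  (forall x, `|phi x| <= M * `|x|) ->
  exists l, forall y, phi y = inner l y.
Proof.
move=> phiD phiZ phiM.
pose f y := inner y y - 2 * phi y.
have fge y : - M ^+ 2 <= f y.
  rewrite /f inner_norm; have := phiM y; have := ler_norm (phi y).
  by have := sqr_ge0 (`|y| - M); nra.
have fi : has_inf (range f).
  split; first by exists (f 0), 0.
  by exists (- M ^+ 2) => _ [y _ <-].
pose m := inf (range f).
have mf y : m <= f y by apply: ge_inf; [case: fi | exists y].
have ex n : exists y, f y < m + n.+1%:R^-1.
  have n0 : 0 < n.+1%:R^-1 :> R by [].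
  by have [_ [y _ <-] yn] := inf_adherent n0 fi; exists y.
have [u un] := choice ex.
(* Parallelogram law: f is within 1/(n+1) of its infimum at u n, and the midpoint
   of u n and u k cannot do better than the infimum. *)
have du n k : `|u n - u k| ^+ 2 <= 2 * n.+1%:R^-1 + 2 * k.+1%:R^-1.
  rewrite -inner_norm.
  have := mf (2^-1 *: (u n + u k)).
  move: (un n) (un k); rewrite /f phiZ phiD !innerE (innerC (u k) (u n)).
  set p := n.+1%:R^-1; set q := k.+1%:R^-1; clearbody p q m; lra.
have cu : cauchy (u @ \oo).
  apply: cauchy_exP => e e0.
  pose d := e ^+ 2 / 4; have d0 : 0 < d by rewrite /d divr_gt0 // exprn_gt0.
  have [N _ hN] := near_infty_natSinv_lt (PosNum d0).
  exists (u N); exists N => // n /= Nn.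
  rewrite -ball_normE /= -(@ltr_pXn2r _ 2) ?nnegrE ?(ltW e0) //.
  apply: le_lt_trans (du _ _) _.
  have := hN N (leqnn N); have := hN n Nn; rewrite /= /d.
  set p := n.+1%:R^-1; set q := N.+1%:R^-1; clearbody p q; lra.
have /cauchy_cvg /cvg_ex[l ul] := cu.
exists l => h.
have ulh := cvg_weakly _ _ ul h.
pose c := inner l h - phi h.
have pos t : 0 <= t ^+ 2 * inner h h + 2 * t * c.
  pose g n := t ^+ 2 * inner h h + 2 * t * (inner (u n) h - phi h) + n.+1%:R^-1.
  have hc : n.+1%:R^-1 @[n --> \oo] --> (0 : R) by exact: cvg_harmonic.
  have bc : inner (u n) h - phi h @[n --> \oo] --> c.
    by apply: cvgB; [exact: ulh | exact: cvg_cst].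
  have tc : 2 * t * (inner (u n) h - phi h) @[n --> \oo] --> 2 * t * c.
    by apply: cvgM; [exact: cvg_cst | exact: bc].
  have gc : g n @[n --> \oo] --> t ^+ 2 * inner h h + 2 * t * c + 0.
    apply: cvgD; last exact: hc.
    by apply: cvgD; [exact: cvg_cst | exact: tc].
  rewrite -[X in _ <= X]addr0; apply: cvgr_ge_lim gc _ => n; rewrite /g.
  have := mf (u n + t *: h); have := un n.
  rewrite /f phiD phiZ !innerE (innerC h (u n)).
  set p := n.+1%:R^-1; clearbody p m; lra.
apply/esym/eqP; rewrite -subr_eq0 -/c.
(* A quadratic in t without constant term is nonnegative only if its linear
   coefficient vanishes; this t makes it negative otherwise. *)
have := pos (- c / (inner h h + 1)); have h0 := inner_ge0 h.
set q := inner h h in h0 *.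
have -> : (- c / (q + 1)) ^+ 2 * q + 2 * (- c / (q + 1)) * c =
  - (c ^+ 2 * (q + 2) / (q + 1) ^+ 2) by field; lra.
rewrite oppr_ge0 pmulr_lle0 ?invr_gt0 ?exprn_gt0 //; last lra.
rewrite pmulr_lle0; last lra.
move=> c0; rewrite -sqrf_eq0; apply/eqP/le_anti; rewrite c0.
exact: sqr_ge0.
Qed.

(** For each [y] the scalars [inner (u n) y] stay in a compact interval, so they
converge along [U]; the limit is a bounded linear functional of [y]. *)
Lemma ultrafilter_weak_compactness {T} (U : set_system T) (u : T -> H) :
  UltraFilter U -> norm_bounded u -> exists l, weakly_cvg_along U u l.
Proof.
move=> UU [M uM].
have lim_ex y : exists c : R, inner (u n) y @[n --> U] --> c /\ `|c| <= M * `|y|.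
  have inI n : `[- (M * `|y|), M * `|y|]%classic (inner (u n) y).
    rewrite /= in_itv /= -ler_norml.
    by apply: le_trans (inner_normM_le _ _) _; apply: ler_wpM2r.
  have [c [cI clc]] := @segment_compact R (- (M * `|y|)) (M * `|y|)
    (inner (u n) y @[n --> U]) _ (filterE _ inI).
  (* A cluster point of an ultrafilter is a limit of it. *)
  exists c; split; last by move: cI; rewrite /= in_itv /= -ler_norml.
  move=> A cA; case: (in_ultra_setVsetC ((fun n => inner (u n) y) @^-1` A) UU) => //.
  by move=> UnA; have [? []] := clc (~` A) A UnA cA.
have [phi /all_and2 [uphi phiM]] := choice lim_ex.
have cvg_uniq (a b : R) (f : T -> R) :
    f n @[n --> U] --> a -> f n @[n --> U] --> b -> a = b.
  by move=> fa fb; apply: norm_cvg_unique fa fb.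
have [x y|c x|l phil] := @riesz_representation phi M _ _ phiM.
- apply: cvg_uniq (uphi _) _; under eq_fun do rewrite innerDr.
  exact: cvgD.
- apply: cvg_uniq (uphi _) _; under eq_fun do rewrite innerZr.
  exact: cvgM (cvg_cst c) (uphi x).
by exists l => y; rewrite -phil.
Qed.

(** If some neighbourhood of [l] were missed on every set of [F], the complement of
its preimage could be added to [F] and the result extended to an ultrafilter. *)
Lemma cvg_ultrafilters {T} {V : topologicalType} {F : set_system T}
    {FF : ProperFilter F} (f : T -> V) (l : V) :
  (forall U, UltraFilter U -> F `<=` U -> f n @[n --> U] --> l) ->
  f n @[n --> F] --> l.
Proof.
move=> ucvg A lA; apply: contrapT => nFA.
have G0 : ProperFilter (within (~` (f @^-1` A)) F).
  apply: Build_ProperFilter_ex.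
  move=> P FP; apply: contrapT => /forallNP nP; apply: nFA.
  move: FP; rewrite /within /=; apply: filterS => x xP.
  by apply: contrapT => /xP /nP.
have [U [UU GU]] := ultraFilterLemma G0.
have FU : F `<=` U by move=> P FP; apply: GU; apply: filterS FP.
have UA : U (f @^-1` A) := ucvg U UU FU A lA.
have UnA : U (~` (f @^-1` A)) by apply: GU; apply: withinT.
by have [x []] := filter_ex (filterI UA UnA).
Qed.

(** The difference of the two squared distances is affine in [w n], with linear part
[2 * inner (w n) (q - p)].  Being convergent along [F], it has the same limit
along [U] and [V], hence [inner p (q - p) = inner q (q - p)]. *)
Lemma opial_uniqueness {T} {F U V : set_system T} {FF : ProperFilter F}
    {UU : ProperFilter U} {VV : ProperFilter V} (w : T -> H) p q :
  F `<=` U -> F `<=` V ->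
  weakly_cvg_along U w p -> weakly_cvg_along V w q ->
  cvg (`|w n - p| ^+ 2 @[n --> F]) -> cvg (`|w n - q| ^+ 2 @[n --> F]) -> p = q.
Proof.
move=> FU FV wp wq /cvg_ex[a wa] /cvg_ex[b wb].
pose g n := `|w n - p| ^+ 2 - `|w n - q| ^+ 2.
have gc : g n @[n --> F] --> a - b by apply: cvgB.
have gE n : g n = 2 * inner (w n) (q - p) + (inner p p - inner q q).
  rewrite /g -!inner_norm !innerE (innerC p (w n)) (innerC q (w n)); ring.
have lim_g (G : set_system T) (GG : ProperFilter G) r : F `<=` G -> weakly_cvg_along G w r ->
    a - b = 2 * inner r (q - p) + (inner p p - inner q q).
  move=> FG wr.
  have gG : g n @[n --> G] --> a - b by move=> A /gc; apply: FG.
  have wG : 2 * inner (w n) (q - p) @[n --> G] --> 2 * inner r (q - p).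
    by apply: cvgM; [exact: cvg_cst | exact: wr].
  suff gG' : g n @[n --> G] --> 2 * inner r (q - p) + (inner p p - inner q q).
    exact: norm_cvg_unique gG gG'.
  rewrite (_ : g = fun n => 2 * inner (w n) (q - p) + (inner p p - inner q q)).
    by apply: cvgD; [exact: wG | exact: cvg_cst].
  exact/funext/gE.
have := lim_g U UU p FU wp; rewrite (lim_g V VV q FV wq) => e.
apply/esym/eqP; rewrite -subr_eq0 -inner_eq0 {1}innerDl innerNl; apply/eqP; lra.
Qed.

End WeakTopology.

(** * Maximal monotone operators *)

Section Maximality.
Context {R : realType} {H : hilbertType R}.
Implicit Types (A : H -> set H).

(** If [(x, v)] is in the graph it is its own witness; otherwise some graph point
makes the inner product negative, since adding [(x, v)] to the graph would
contradict maximality.  The common form lets several operators be treated at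
once: when witnesses for each of them have a nonnegative sum, every term is 0. *)
Lemma maximal_monotone_witness A x v : maximal_monotone A ->
  exists p u, [/\ A p u, inner (x - p) (v - u) <= 0 &
    0 <= inner (x - p) (v - u) -> A x v].
Proof.
move=> [Amono Amax].
have [Axv|nAxv] := pselect (A x v).
  by exists x, v; split=> //; rewrite subrr inner0l.
apply: contrapT => none; apply: nAxv.
have above p u : A p u -> 0 <= inner (x - p) (v - u).
  move=> Apu; rewrite leNgt; apply/negP => neg; apply: none.
  by exists p, u; split=> //; [exact: ltW | rewrite leNgt neg].
pose T y := A y `|` [set w | y = x /\ w = v].
have TA : T = A.
  apply: Amax => [y z u w|y u]; last by left.
  case=> [Ayu|[-> ->]] [Azw|[-> ->]].
  - exact: Amono.
  - by rewrite -[y - x]opprB -[u - v]opprB innerNl innerNr opprK; exact: above.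
  - exact: above.
  - by rewrite subrr inner0l.
by rewrite -TA; right.
Qed.

(** The inner products [inner (x n) (a n)], [inner (z n) (b n)] and
[inner (x n) (c n)] need not converge separately, but their sum is
[inner (x n) (a n + b n + c n) - inner (x n - z n) (b n)], which tends to 0.  So
the sum of the three monotonicity inequalities passes to the weak limit. *)
Lemma demiclosed_sum {T} {F : set_system T} {FF : ProperFilter F}
    (A1 A2 A3 : H -> set H) (x z a b c : T -> H) xb ab cb :
  maximal_monotone A1 -> maximal_monotone A2 -> maximal_monotone A3 ->
  (forall n, A1 (x n) (a n)) -> (forall n, A2 (z n) (b n)) ->
  (forall n, A3 (x n) (c n)) ->
  norm_bounded x -> norm_bounded b ->
  x n - z n @[n --> F] --> (0 : H) ->
  a n + b n + c n @[n --> F] --> (0 : H) ->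
  weakly_cvg_along F x xb -> weakly_cvg_along F a ab ->
  weakly_cvg_along F c cb ->
  [/\ A1 xb ab, A2 xb (- (ab + cb)) & A3 xb cb].
Proof.
move=> M1 M2 M3 A1a A2b A3c xbd bbd xz0 abc0 xw aw cw.
set bb := - (ab + cb).
have bw : weakly_cvg_along F b bb.
  rewrite -[bb]add0r (_ : b = fun n => (a n + b n + c n) + - (a n + c n)).
    apply: weakly_cvgD; first exact: cvg_weakly.
    by apply: weakly_cvgN; exact: weakly_cvgD.
  by apply/funext => n; rewrite opprD addrACA [a n + b n]addrC addrK subrr addr0.
have zw : weakly_cvg_along F z xb.
  rewrite -[xb]addr0 -oppr0 (_ : z = fun n => x n + - (x n - z n)).
    by apply: weakly_cvgD => //; apply: weakly_cvgN; exact: cvg_weakly.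
  by apply/funext => n; rewrite opprB addrC subrK.
have [p [u [A1pu le1 in1]]] := maximal_monotone_witness _ xb ab M1.
have [q [v [A2qv le2 in2]]] := maximal_monotone_witness _ xb bb M2.
have [r [t [A3rt le3 in3]]] := maximal_monotone_witness _ xb cb M3.
(* The sum of the three monotonicity expressions at n, arranged so that every
   term converges. *)
pose g n := inner (a n + b n + c n) (x n) - inner (x n - z n) (b n)
  - inner (x n) u - inner (a n) p + inner p u
  - inner (z n) v - inner (b n) q + inner q v
  - inner (x n) t - inner (c n) r + inner r t.
have g0 n : 0 <= g n.
  have := M1.1 _ _ _ _ (A1a n) A1pu; have := M2.1 _ _ _ _ (A2b n) A2qv.
  have := M3.1 _ _ _ _ (A3c n) A3rt.
  rewrite /g !innerE (innerC (a n)) (innerC (b n)) (innerC (c n))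
    (innerC (a n)) (innerC (b n)) (innerC (c n)).
  lra.
have gc : g n @[n --> F] --> 0 - 0 - inner xb u - inner ab p + inner p u
  - inner xb v - inner bb q + inner q v
  - inner xb t - inner cb r + inner r t.
  do 9! [apply: cvgD; last by [apply: cvg_cst | apply: cvgN; auto]].
  by apply: cvgB; apply: inner_cvg0.
have := @cvgr_ge_lim _ _ _ FF _ _ _ gc g0.
have sum0 : inner ab xb + inner bb xb + inner cb xb = 0.
  by rewrite -!innerDl /bb opprD addrA subrr add0r addNr inner0l.
clearbody bb; move: le1 le2 le3 in1 in2 in3.
rewrite !innerE (innerC xb ab) (innerC xb bb) (innerC xb cb)
  (innerC p ab) (innerC q bb) (innerC r cb) => le1 le2 le3 in1 in2 in3 sge.
by split; [apply: in1 | apply: in2 | apply: in3]; lra.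
Qed.

End Maximality.

(** * One step of the method *)

Section PointwiseEstimates.
Context {R : realType} {H : hilbertType R}.

(** Here [d1], [d2] stand for the differences of two values of [x1] and [x2], and
[e1], [e2], [eb] for those of [gamma a1], [gamma a2] and [gamma B x1], with
[g = gamma beta].  Writing [s = d1 - d2], the inner product times [g] equals
[g <d1, e1> + g <d2, e2> + (g <d1, eb> - |eb|^2) + |eb - (g / 2) s|^2];
the coefficient [1 - g / 4] is what completes the last square. *)
Lemma davis_yin_monotone (g : R) (d1 d2 e1 e2 eb : H) :
  0 < g -> d1 - d2 = e1 + e2 + eb ->
  0 <= inner d1 e1 -> 0 <= inner d2 e2 -> inner eb eb <= g * inner d1 eb ->
  0 <= inner (d1 - d2) (d1 + e1 - (1 - g / 4) *: (d1 - d2)).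
Proof.
move=> g0 dE i1 i2 ib.
have {}dE : e1 = d1 - d2 - eb - e2 by rewrite dE addrK addrK.
rewrite -(pmulr_rge0 _ g0).
have sq := inner_ge0 (eb - (g / 2) *: (d1 - d2)).
have gi1 := mulr_ge0 (ltW g0) i1; have gi2 := mulr_ge0 (ltW g0) i2.
move: sq gi1 gi2 ib; rewrite dE !innerE.
rewrite (innerC d2 d1) (innerC eb d1) (innerC eb d2).
lra.
Qed.

(** Expanding the squares,
[`|w - v - q|^2 = `|w - q|^2 - 2 <v, y - q> + `|y + v - w|^2 - `|y - w|^2]. *)
Lemma hybrid_proximal_step (sigma : R) (w y v q : H) : 0 <= sigma ->
  0 <= inner v (y - q) -> `|y + v - w| <= sigma * `|y - w| ->
  `|w - v - q| ^+ 2 <= `|w - q| ^+ 2 - (1 - sigma ^+ 2) * `|y - w| ^+ 2.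
Proof.
move=> s0 vq err.
have : `|y + v - w| ^+ 2 <= sigma ^+ 2 * `|y - w| ^+ 2.
  by rewrite -exprMn ler_pXn2r ?nnegrE ?mulr_ge0.
rewrite mulrBl mul1r; move: (sigma ^+ 2 * _) => c.
move: vq; rewrite -!inner_norm !innerE.
rewrite (innerC v y) (innerC v w) (innerC v q) (innerC y w) (innerC q w).
lra.
Qed.

End PointwiseEstimates.

(** * Bounded families of vectors *)

Section NormBounded.
Context {R : realType} {H : hilbertType R} {T : Type}.
Implicit Types (u v : T -> H).

Lemma norm_boundedD u v : norm_bounded u -> norm_bounded v ->
  norm_bounded (fun n => u n + v n).
Proof.
move=> [M uM] [N vN]; exists (M + N) => n.
by apply: le_trans (ler_normD _ _) _; apply: lerD.
Qed.

Lemma norm_bounded_le c u v : 0 <= c -> norm_bounded u ->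
  (forall n, `|v n| <= c * `|u n|) -> norm_bounded v.
Proof.
move=> c0 [M uM] vu; exists (c * M) => n.
by apply: le_trans (vu n) _; apply: ler_wpM2l.
Qed.

Lemma norm_boundedZ c u : norm_bounded u -> norm_bounded (fun n => c *: u n).
Proof.
by move=> ub; apply: (norm_bounded_le `|c| _ _ (normr_ge0 c)) ub _ => n; rewrite normrZ.
Qed.

Lemma norm_boundedN u : norm_bounded u -> norm_bounded (fun n => - u n).
Proof. by move=> [M uM]; exists M => n; rewrite normrN. Qed.

Lemma norm_bounded_cst (l : H) : norm_bounded (fun _ : T => l).
Proof. by exists `|l|. Qed.

Lemma norm_bounded_sqr c u : (forall n, `|u n| ^+ 2 <= c) -> norm_bounded u.
Proof.
move=> uc; exists (c + 1) => n; have := uc n.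
by have := normr_ge0 (u n); nra.
Qed.

End NormBounded.

(** * Convergence of the iterates *)

Section InexactDavisYin.
Context {R : realType} {H : hilbertType R}.
Context {A1 A2 : H -> set H} {B : H -> H} {beta gamma sigma : R}.
Context {x a z b w : nat -> H}.

(* x, a, z and b are the method's x1, a1, x2 and the element of A2 x2 selected by
   the resolvent, with indices shifted so that they start at 0. *)
Let lambda : R := 1 - gamma * beta / 4.
Let y n := x n + gamma *: a n - lambda *: (x n - z n).

Context (A1max : maximal_monotone A1) (A2max : maximal_monotone A2)
  (Bmax : maximal_monotone (single_valued B)).
Context (beta0 : 0 < beta) (Bcoco : cocoercive (1 / beta) B)
  (gamma0 : 0 < gamma) (lambda0 : 0 < lambda) (sigma01 : 0 <= sigma < 1).
Context (A1a : forall n, A1 (x n) (a n)) (A2b : forall n, A2 (z n) (b n))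
  (gap : forall n, x n - z n = gamma *: (a n + b n + B (x n)))
  (error : forall n, `|x n + gamma *: a n - w n| <= sigma * `|y n - w n|)
  (update : forall n, w n.+1 = w n - lambda *: (x n - z n)).

(** Solutions [p] of the inclusion together with the element [u] of [A1 p] that
certifies it: the auxiliary sequence [w] approaches [p + gamma *: u]. *)
Definition primal_dual_solution p u := A1 p u /\ A2 p (- (u + B p)).

Lemma cocoercive_inner p r :
  inner (B p - B r) (B p - B r) <= beta * inner (p - r) (B p - B r).
Proof.
rewrite (innerC (p - r)) inner_norm mulrC -ler_pdivrMr // mulrC -[beta^-1]mul1r.
exact: Bcoco.
Qed.

Lemma fejer_decrease p u n : primal_dual_solution p u ->
  `|w n.+1 - (p + gamma *: u)| ^+ 2 <=
  `|w n - (p + gamma *: u)| ^+ 2 - (1 - sigma ^+ 2) * `|y n - w n| ^+ 2.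
Proof.
move=> [A1pu A2pu]; rewrite update.
have [s0 _] := andP sigma01.
apply: hybrid_proximal_step => //; last first.
  by rewrite /y subrK.
rewrite innerZl; apply: mulr_ge0; first exact: ltW.
have := @davis_yin_monotone R H (gamma * beta) (x n - p) (z n - p)
  (gamma *: (a n - u)) (gamma *: (b n + (u + B p))) (gamma *: (B (x n) - B p)).
rewrite -/lambda.
have -> : x n - p - (z n - p) = x n - z n by rewrite opprB addrA subrK.
have -> : y n - (p + gamma *: u) =
    x n - p + gamma *: (a n - u) - lambda *: (x n - z n).
  by apply: inner_ext => h; rewrite /y !innerE; ring.
apply.
- exact: mulr_gt0.
- by apply: inner_ext => h; rewrite gap !innerE; ring.
- by rewrite innerZr; apply: mulr_ge0; [exact: ltW | exact: (A1max.1)].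
- rewrite innerZr; apply: mulr_ge0; first exact: ltW.
  by have := A2max.1 _ _ _ _ (A2b n) A2pu; rewrite opprK.
- rewrite innerZr innerZl innerZr.
  have := cocoercive_inner (x n) p.
  have g2 : 0 <= gamma * gamma by rewrite mulr_ge0 // ltW.
  by move/(ler_wpM2l g2); lra.
Qed.

Lemma one_sub_sigma2_gt0 : 0 < 1 - sigma ^+ 2.
Proof. by have := sigma01; nra. Qed.

Lemma anchor_dist_cvg p u : primal_dual_solution p u ->
  cvg (`|w n - (p + gamma *: u)| ^+ 2 @[n --> \oo]).
Proof.
move=> sol; apply: nonincreasing_is_cvgn.
  apply/nonincreasing_seqP => n; apply: le_trans (fejer_decrease _ _ n sol) _.
  by rewrite gerBl mulr_ge0 ?sqr_ge0 // ltW // one_sub_sigma2_gt0.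
by exists 0 => _ [n _ <-]; exact: sqr_ge0.
Qed.

Lemma proximal_residual_cvg0 p u : primal_dual_solution p u ->
  y n - w n @[n --> \oo] --> (0 : H).
Proof.
move=> sol; have s1 := one_sub_sigma2_gt0.
pose D n := `|w n - (p + gamma *: u)| ^+ 2.
have /cvg_ex[d Dd] := anchor_dist_cvg _ _ sol.
have DS : D n - D n.+1 @[n --> \oo] --> (0 : R).
  rewrite -(subrr d); apply: cvgB; first exact: Dd.
  by have := Dd; rewrite -cvg_shiftS.
apply/cvgr0Pnorm_le => e e0.
have ee : 0 < (1 - sigma ^+ 2) * e ^+ 2 by rewrite mulr_gt0 // exprn_gt0.
apply: filterS (cvgr0_norm_le _ DS _ ee) => n Dn.
rewrite -(@ler_pXn2r _ 2) ?nnegrE ?(ltW e0) // -(ler_pM2l s1).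
apply: le_trans Dn; apply: le_trans (ler_norm _).
by have := fejer_decrease _ _ n sol; rewrite -/(D _) -/(D _); lra.
Qed.

(** [lambda *: (x n - z n)] is the difference of [x n + gamma *: a n - w n], which the
error criterion bounds, and [y n - w n]. *)
Lemma norm_proximal_gap_le n :
  `|x n - z n| <= lambda^-1 * (1 + sigma) * `|y n - w n|.
Proof.
rewrite -mulrA ler_pdivlMl // -{1}(gtr0_norm lambda0) -normrZ.
rewrite (_ : lambda *: _ = (x n + gamma *: a n - w n) - (y n - w n)).
  by apply: le_trans (ler_normB _ _) _; rewrite mulrDl mul1r addrC lerD2l.
by apply: inner_ext => h; rewrite /y !innerE; ring.
Qed.

Lemma cvg0_of_residual (v : nat -> H) c : 0 <= c ->
  y n - w n @[n --> \oo] --> (0 : H) ->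
  (forall n, `|v n| <= c * `|y n - w n|) -> v n @[n --> \oo] --> (0 : H).
Proof.
move=> c0 /norm_cvg0P yw0 vy; apply/norm_cvg0P.
have cy : c * `|y n - w n| @[n --> \oo] --> 0.
  by rewrite -[X in _ --> X](mulr0 c); apply: cvgM; [exact: cvg_cst | exact: yw0].
apply: squeeze_cvgr (cvg_cst 0) cy.
by apply: nearW => n; rewrite normr_ge0 vy.
Qed.

Section GivenSolution.
Context {p u : H} (sol : primal_dual_solution p u).

Lemma proximal_gap_cvg0 : x n - z n @[n --> \oo] --> (0 : H).
Proof.
apply: cvg0_of_residual _ _ _ (proximal_residual_cvg0 _ _ sol) norm_proximal_gap_le.
by have [s0 _] := andP sigma01; rewrite mulr_ge0 ?invr_ge0 ?(ltW lambda0) ?addr_ge0.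
Qed.

Lemma anchor_gap_cvg0 : x n + gamma *: a n - w n @[n --> \oo] --> (0 : H).
Proof.
apply: cvg0_of_residual _ _ _ (proximal_residual_cvg0 _ _ sol) error.
by case/andP: sigma01.
Qed.

Lemma norm_bounded_iterates :
  [/\ norm_bounded x, norm_bounded a, norm_bounded b & norm_bounded (B \o x)].
Proof.
have s1 := one_sub_sigma2_gt0; have [s0 _] := andP sigma01.
set q := p + gamma *: u.
have wle n : `|w n - q| ^+ 2 <= `|w 0%N - q| ^+ 2.
  elim: n => // n IH; apply: le_trans (fejer_decrease _ _ n sol) (le_trans _ IH).
  by rewrite gerBl mulr_ge0 ?sqr_ge0 // ltW.
have wb : norm_bounded (fun n => w n - q) by exact: norm_bounded_sqr _ _ wle.
have yb : norm_bounded (fun n => y n - w n).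
  apply: (@norm_bounded_sqr _ _ _ ((1 - sigma ^+ 2)^-1 * `|w 0%N - q| ^+ 2)) => n.
  rewrite ler_pdivlMl //; have := fejer_decrease _ _ n sol; have := wle n.
  by have := sqr_ge0 `|w n.+1 - q|; rewrite -/q; lra.
have pb : norm_bounded (fun n => (x n + gamma *: a n - w n) + (w n - q)).
  apply: norm_boundedD => //; exact: norm_bounded_le _ _ _ s0 yb error.
have split_sq n : `|x n + gamma *: a n - w n + (w n - q)| ^+ 2 =
    `|x n - p| ^+ 2 + `|gamma *: (a n - u)| ^+ 2
    + 2 * (gamma * inner (x n - p) (a n - u)).
  rewrite (_ : _ + (w n - q) = (x n - p) + gamma *: (a n - u)).
    rewrite -!inner_norm !innerE (innerC (a n) (x n)) (innerC (a n) p).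
    by rewrite (innerC u (x n)) (innerC u p); ring.
  by apply: inner_ext => h; rewrite /q !innerE; ring.
(* By monotonicity of A1 the cross term is nonnegative, so bounding the sum
   bounds both summands: the resolvent of gamma A1 is nonexpansive. *)
have cross n : 0 <= 2 * (gamma * inner (x n - p) (a n - u)).
  by rewrite !mulr_ge0 ?(ltW gamma0) //; apply: A1max.1 => //; case: sol.
have xpb : norm_bounded (fun n => x n - p).
  apply: (norm_bounded_le 1 _ _ ler01) pb _ => n; rewrite mul1r.
  rewrite -(@ler_pXn2r _ 2) ?nnegrE // split_sq.
  by have := cross n; have := sqr_ge0 `|gamma *: (a n - u)|; lra.
have aub : norm_bounded (fun n => gamma *: (a n - u)).
  apply: (norm_bounded_le 1 _ _ ler01) pb _ => n; rewrite mul1r.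
  rewrite -(@ler_pXn2r _ 2) ?nnegrE // split_sq.
  by have := cross n; have := sqr_ge0 `|x n - p|; lra.
have xb : norm_bounded x.
  by have := norm_boundedD _ _ xpb (norm_bounded_cst p); under eq_fun do rewrite subrK.
have ab : norm_bounded a.
  have := norm_boundedD _ _ (norm_boundedZ gamma^-1 _ aub) (norm_bounded_cst u).
  by under eq_fun do rewrite scalerA mulVf ?gt_eqF // scale1r subrK.
have Bpb : norm_bounded (fun n => B (x n) - B p).
  apply: norm_bounded_le _ _ _ (ltW beta0) xpb _ => n.
  have := cocoercive_inner (x n) p; rewrite inner_norm.
  have := inner_normM_le (x n - p) (B (x n) - B p).
  have := ler_norm (inner (x n - p) (B (x n) - B p)).
  set c := inner _ _; set d := `|B (x n) - B p|; set e := `|x n - p| => h1 h2 h3.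
  (* Cancel d in d^2 <= beta * e * d. *)
  have [->|d0] := eqVneq d 0; first by rewrite mulr_ge0 ?normr_ge0 // ltW.
  have dp : 0 < d by rewrite lt0r d0 normr_ge0.
  rewrite -(ler_pM2r dp) -expr2 -mulrA; apply: le_trans h3 _.
  by rewrite ler_pM2l //; exact: le_trans h1 h2.
have Bb : norm_bounded (B \o x).
  by have := norm_boundedD _ _ Bpb (norm_bounded_cst (B p)); under eq_fun do rewrite subrK.
have gb : norm_bounded (fun n => x n - z n).
  apply: norm_bounded_le _ _ _ _ yb norm_proximal_gap_le.
  by rewrite mulr_ge0 ?invr_ge0 ?(ltW lambda0) ?addr_ge0.
split=> //.
have -> : b = (fun n => gamma^-1 *: (x n - z n) + - (a n + B (x n))).
  apply/funext => n; rewrite gap scalerA mulVf ?gt_eqF // scale1r.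
  by apply: inner_ext => h; rewrite !innerE; ring.
apply: norm_boundedD; first exact: norm_boundedZ.
by apply: norm_boundedN; exact: norm_boundedD.
Qed.

Lemma weak_cluster_is_solution U : UltraFilter U -> \oo `<=` U ->
  exists r v, [/\ primal_dual_solution r v, weakly_cvg_along U x r &
    weakly_cvg_along U w (r + gamma *: v)].
Proof.
move=> UU oU; have [xb ab bb Bb] := norm_bounded_iterates.
have along (f : nat -> H) (l : H) : f n @[n --> \oo] --> l -> f n @[n --> U] --> l.
  by move=> fl A /fl; apply: oU.
have [r xr] := ultrafilter_weak_compactness _ x UU xb.
have [v av] := ultrafilter_weak_compactness _ a UU ab.
have [c Bc] := ultrafilter_weak_compactness _ _ UU Bb.
have abB : a n + b n + B (x n) @[n --> U] --> (0 : H).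
  rewrite (_ : (fun n => _) = (fun n => gamma^-1 *: (x n - z n))).
    rewrite -[X in _ --> X](scaler0 _ gamma^-1); apply: cvgZr.
    exact: along _ _ proximal_gap_cvg0.
  by apply/funext => n; rewrite gap scalerA mulVf ?gt_eqF // scale1r.
have [A1rv A2rv cE] := demiclosed_sum _ _ _ _ _ _ _ _ _ _ _ A1max A2max Bmax A1a A2b
  (fun n => erefl) xb bb (along _ _ proximal_gap_cvg0) abB xr av Bc.
exists r, v; split=> //; first by split=> //; rewrite -cE.
rewrite (_ : w = fun n => (x n + gamma *: a n) + - (x n + gamma *: a n - w n)).
  rewrite -[r + _]addr0 -oppr0; apply: weakly_cvgD.
    by apply: weakly_cvgD => //; exact: weakly_cvgZ.
  by apply: weakly_cvgN; apply: cvg_weakly; exact: along _ _ anchor_gap_cvg0.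
by apply/funext => n; rewrite opprB addrC subrK.
Qed.

(** Both [r] and [r'] are the resolvent of [gamma A1] at the common point. *)
Lemma primal_dual_solution_anchor_inj r v r' v' :
  primal_dual_solution r v -> primal_dual_solution r' v' ->
  r + gamma *: v = r' + gamma *: v' -> r = r'.
Proof.
move=> [A1rv _] [A1rv' _] e.
have := mulr_ge0 (ltW gamma0) (A1max.1 _ _ _ _ A1rv A1rv').
rewrite -innerZr (_ : gamma *: _ = - (r - r')); last first.
  apply: inner_ext => h; have := congr1 (inner^~ h) e.
  rewrite /= !innerE; lra.
rewrite innerNr oppr_ge0 => le0; apply/eqP; rewrite -subr_eq0 -inner_eq0.
by rewrite eq_le le0 inner_ge0.
Qed.

Lemma weak_convergence : exists r v, [/\ primal_dual_solution r v,
  weakly_converges x r & weakly_converges z r].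
Proof.
have [U0 [UU0 oU0]] := ultraFilterLemma (_ : ProperFilter \oo).
have [r [v [solr xr wr]]] := weak_cluster_is_solution _ UU0 oU0.
have xcvg : weakly_cvg_along \oo x r.
  move=> h; apply: cvg_ultrafilters => U UU oU.
  have [r' [v' [solr' xr' wr']]] := weak_cluster_is_solution _ UU oU.
  rewrite (_ : r = r'); first exact: xr'.
  apply: (primal_dual_solution_anchor_inj _ _ _ _ solr solr').
  exact: opial_uniqueness _ _ _ oU0 oU wr wr' (anchor_dist_cvg _ _ solr) (anchor_dist_cvg _ _ solr').
exists r, v; split=> //.
rewrite (_ : z = fun n => x n + - (x n - z n)).
  rewrite -[r]addr0 -oppr0; apply: weakly_cvgD => //; apply: weakly_cvgN.
  by apply: cvg_weakly; exact: proximal_gap_cvg0.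
by apply/funext => n; rewrite opprB addrC subrK.
Qed.

End GivenSolution.
End InexactDavisYin.

Theorem theorem3p5 (R : realType) (H : hilbertType R)
    (A1 A2 : H -> set H) (B : H -> H)
    (hA1 : maximal_monotone A1)
    (hA2 : maximal_monotone A2)
    (hB : maximal_monotone (single_valued B))
    (beta : R) (hbeta : 0 < beta)
    (hcoco : cocoercive (1 / beta) B)
    (hP : exists x : H, zeros (op_add (op_add A1 A2) (single_valued B)) x)
    (sigma : R) (hsigma : 0 <= sigma < 1)
    (gamma : R) (hgamma : 0 < gamma < 2 / beta)
    (alpha : R) (halpha : alpha = (gamma * beta) / (4 - gamma * beta))
    (w0 : H) (w x1 a1 x2 : nat -> H)
    (hidy : inexact_davis_yin A1 A2 B alpha gamma sigma w0 w x1 a1 x2) :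
  exists x : H,
    [/\ zeros (op_add (op_add A1 A2) (single_valued B)) x,
        weakly_converges x1 x & weakly_converges x2 x].
Proof.
have [gamma0] := andP hgamma; rewrite ltr_pdivlMr // => gb2.
have gb0 : 0 < gamma * beta by rewrite mulr_gt0.
have lambdaE : (1 + alpha)^-1 = 1 - gamma * beta / 4.
  have g4 : 4 - gamma * beta != 0 by lra.
  have -> : 1 + alpha = 4 / (4 - gamma * beta) by rewrite halpha; field.
  by rewrite invf_div; field.
have zerosE x : zeros (op_add (op_add A1 A2) (single_valued B)) x <->
    exists u, primal_dual_solution (A1 := A1) (A2 := A2) (B := B) x u.
  split=> [[_ [u A1u [v A2v <-]] [_ -> ]] uvB|[u [A1u A2u]]].
    exists u; split=> //; rewrite (_ : - _ = v) //.
    by apply/eqP; rewrite eqr_oppLR -addr_eq0 addrAC uvB.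
  exists (u - (u + B x)); first by exists u => //; exists (- (u + B x)).
  by exists (B x) => //; rewrite opprD addrA subrr add0r addNr.
have [_ A1a res error update] := hidy.
have /choice[b bE] n : exists b, A2 (x2 n.+1) b /\
    x2 n.+1 + gamma *: b = x1 n.+1 - gamma *: a1 n.+1 - gamma *: B (x1 n.+1).
  by have [_ -> [_ [b A2b <-] e]] := res n; exists b.
have [p /zerosE [u sol]] := hP.
have := @weak_convergence R H A1 A2 B beta gamma sigma (fun n => x1 n.+1)
  (fun n => a1 n.+1) (fun n => x2 n.+1) b w hA1 hA2 hB hbeta hcoco gamma0 _ hsigma
  A1a (fun n => (bE n).1) _ _ _ p u sol.
case=> [|n|n|n|r [v [solr xr zr]]].
- lra.
- apply: inner_ext => h; have := congr1 (inner^~ h) (bE n).2.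
  rewrite /= !innerE; lra.
- apply: le_trans (error n) _; rewrite -lambdaE.
  rewrite (_ : _ *: _ + _ - _ = x1 n.+1 + gamma *: a1 n.+1
      - (1 + alpha)^-1 *: (x1 n.+1 - x2 n.+1) - w n) //.
  have a0 : 1 + alpha != 0 by rewrite -invr_eq0 lambdaE; lra.
  by apply: inner_ext => h; rewrite !innerE; field.
- by rewrite update -lambdaE -scalerN opprB.
exists r; split; first by apply/zerosE; exists v.
- by move=> h; have := xr h; rewrite -(cvg_shiftS (fun n => inner (x1 n) h)).
- by move=> h; have := zr h; rewrite -(cvg_shiftS (fun n => inner (x2 n) h)).
Qed.
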